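(* Let $N\ge 4$ be an integer and $p\in\mathbb{Z}\setminus\{0,1,-1\}$. Then there are at most $2(N-1)$ values of the ratio $a/b$ (with $a,b\in\mathbb{R}$, $ab\neq 0$) for which the $N$-body choreographic motion on the $p$-limaçon curve $z(t)=ae^{it}+be^{ipt}$ experiences collisions.
   Context: The $N$-body choreographic motion on the $p$-limaçon curve $z(t)=ae^{it}+be^{ipt}\in\mathbb{C}$ is $z_k(t)=z\left(t+\frac{2\pi k}{N}\right)$, $k=0,1,\dots,N-1$. It experiences a collision if there are a time $t^*\in\mathbb{R}$ and indices $k\neq k'$ in $\{0,\dots,N-1\}$ with $z_k(t^* )=z_{k'}(t^* )$. *)

(* Defs.v *)
From HB Require Import structures.
From mathcomp Require Import all_boot all_order all_algebra.
From mathcomp Require Import all_classical all_reals all_analysis.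
From mathcomp Require Import complex.

Set Implicit Arguments.
Unset Strict Implicit.
Unset Printing Implicit Defensive.

Import Order.TTheory GRing.Theory Num.Theory.

Local Open Scope ring_scope.
Local Open Scope complex_scope.

(* [expi x] is e^{ix}; neither library provides a complex exponential. *)
Definition expi (R : realType) (x : R) : R[i] := cos x +i* sin x.

Definition limacon (R : realType) (p : int) (a b : R) (t : R) : R[i] :=
  a%:C * expi t + b%:C * expi (p%:~R * t).

Definition body (R : realType) (N : nat) (p : int) (a b : R) (k : 'I_N)
    (t : R) : R[i] :=
  limacon p a b (t + 2 * pi * k%:R / N%:R).

Definition has_collision (R : realType) (N : nat) (p : int) (a b : R) : Prop :=
  exists (t : R) (k k' : 'I_N), k != k' /\ body p a b k t = body p a b k' t.

Definition collision_ratios (R : realType) (N : nat) (p : int) : set R :=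
  [set r | exists a b : R, [/\ a * b != 0, r = a / b & has_collision N p a b]]%classic.

Arguments collision_ratios : clear implicits.

(* Main.v *)
Require Import Defs.
From HB Require Import structures.
From mathcomp Require Import all_boot all_order all_algebra.
From mathcomp Require Import all_classical all_reals all_analysis.
From mathcomp Require Import complex ring lra zify.

Import Order.TTheory GRing.Theory Num.Theory.
Local Open Scope ring_scope.
Local Open Scope classical_set_scope.
Local Open Scope card_scope.

(** At a collision, the bodies sit at parameters [x] and [y] of the curve with
    [x - y = 2 * theta], where [theta = pi * d / N] and [d] is the difference
    of the two indices.  The collision equation reads
    [a (e^{ix} - e^{iy}) = - b (e^{ipx} - e^{ipy})].  The chord of the unit
    circle from [e^{iy}] to [e^{ix}] has length [2 |sin theta|], and the one
    from [e^{ipy}] to [e^{ipx}] has length [2 |sin (p theta)|]; taking moduli,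
    [|a sin theta| = |b sin (p theta)|] ([limacon_double_point]).  The time of
    the collision has disappeared, and [sin theta] is nonzero because
    [0 < d < N].  Hence [a / b] is one of the two numbers
    [+- sin (p theta) / sin theta], and as [d] takes [N - 1] values this leaves
    at most [2 (N - 1)] ratios. *)

(** Both sides are the squared length of a chord of the unit circle. *)
Lemma sqr_chord (R : realType) (x y : R) :
  (cos x - cos y) ^+ 2 + (sin x - sin y) ^+ 2 = 4 * sin ((x - y) / 2) ^+ 2.
Proof.
have half_angle : cos (x - y) = 1 - 2 * sin ((x - y) / 2) ^+ 2.
  rewrite [in LHS](splitr (x - y)) cosD -!expr2 cos2sin2; ring.
have Hx := cos2Dsin2 x; have Hy := cos2Dsin2 y.
move: half_angle; rewrite cosB => half_angle.
lra.
Qed.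

(** Only the difference of the two parameters survives, since the moduli of
    [e^{ix} - e^{iy}] and [e^{ipx} - e^{ipy}] depend on nothing else. *)
Lemma limacon_double_point (R : realType) (p : int) (a b x y : R) :
  limacon p a b x = limacon p a b y ->
  (a * sin ((x - y) / 2)) ^+ 2 = (b * sin (p%:~R * ((x - y) / 2))) ^+ 2.
Proof.
rewrite /limacon /expi; simpc => -[eq_re eq_im].
have Hx := sqr_chord _ x y.
have := sqr_chord _ (p%:~R * x) (p%:~R * y).
rewrite -mulrBr -mulrA => Hpx.
have re_diff : a * (cos x - cos y) =
    - (b * (cos (p%:~R * x) - cos (p%:~R * y))) by lra.
have im_diff : a * (sin x - sin y) =
    - (b * (sin (p%:~R * x) - sin (p%:~R * y))) by lra.
have : a ^+ 2 * (4 * sin ((x - y) / 2) ^+ 2) =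
    b ^+ 2 * (4 * sin (p%:~R * ((x - y) / 2)) ^+ 2).
  rewrite -Hx -Hpx !mulrDr -!exprMn re_diff im_diff; ring.
by rewrite !exprMn; lra.
Qed.

Lemma sin_pi_frac_gt0 (R : realType) (N d : nat) :
  (0 < d < N)%N -> 0 < sin (pi * d%:R / N%:R : R).
Proof.
move=> /andP[d_gt0 d_ltN].
have N_gt0 : 0 < N%:R :> R by rewrite ltr0n (ltn_trans d_gt0).
apply: sin_gt0_pi.
apply/andP; split; first by rewrite divr_gt0 // mulr_gt0 ?pi_gt0 ?ltr0n.
by rewrite ltr_pdivrMr // ltr_pM2l ?pi_gt0 // ltr_nat.
Qed.

Definition sin_ratio (R : realType) (N : nat) (p : int) (d : nat) : R :=
  sin (p%:~R * (pi * d%:R / N%:R)) / sin (pi * d%:R / N%:R).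

(** A collision is symmetric in the two bodies, so their indices may be ordered
    and [d] taken to be their positive difference. *)
Lemma has_collision_ratio (R : realType) (N : nat) (p : int) (a b : R) :
  b != 0 -> has_collision N p a b ->
  exists2 d, (0 < d < N)%N &
    a / b = sin_ratio R N p d \/ a / b = - sin_ratio R N p d.
Proof.
move=> b_neq0 [t [k [k' [k_neq]]]].
wlog lt_k : k k' k_neq / (k' < k)%N.
  move=> ordered collide; case: (ltngtP k' k) => lt_k.
  - exact: ordered collide.
  - by apply: ordered (esym collide); rewrite // eq_sym.
  - by rewrite (val_inj lt_k) eqxx in k_neq.
have d_bounds : (0 < k - k' < N)%N.
  by rewrite subn_gt0 lt_k (leq_ltn_trans (leq_subr _ _)).
have N_neq0 : N%:R != 0 :> R by rewrite pnatr_eq0; lia.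
move=> /limacon_double_point.
have -> : (t + 2 * pi * k%:R / N%:R - (t + 2 * pi * k'%:R / N%:R)) / 2 =
    pi * (k - k')%:R / N%:R.
  by rewrite natrB ?(ltnW lt_k) //; field.
have sin_neq0 := lt0r_neq0 (sin_pi_frac_gt0 R N _ d_bounds).
move=> /eqP; rewrite eqf_sqr => /orP[] /eqP sin_eq; exists (k - k')%N => //.
  left; apply/eqP; rewrite /sin_ratio eqr_div // sin_eq; apply/eqP; ring.
right; apply/eqP; rewrite /sin_ratio -mulNr eqr_div // sin_eq.
by apply/eqP; ring.
Qed.

Theorem proposition3 (R : realType) (N : nat) (p : int) (hN : (4 <= N)%N)
    (hp0 : p != 0) (hp1 : p != 1) (hpN1 : p != -1) :
  collision_ratios R N p #<= `I_(2 * (N - 1)).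
Proof.
(* The candidates are listed in pairs: positions [2 (d - 1)] and
   [2 (d - 1) + 1] hold the two signs of the ratio attached to [d]. *)
pose candidate j : R := (-1) ^+ odd j * sin_ratio R N p j./2.+1.
apply: card_le_trans (card_image_le candidate `I_(2 * (N - 1))).
apply: subset_card_le => _ [a [b [ab_neq0 -> collide]]].
have b_neq0 : b != 0 by move: ab_neq0; rewrite mulf_eq0 => /norP[].
have [[//|d] /andP[_ d_ltN] ratio_eq] := has_collision_ratio _ _ _ _ _ b_neq0 collide.
case: ratio_eq => ->.
  exists d.*2 => /=; first lia.
  by rewrite /candidate odd_double doubleK mul1r.
exists d.*2.+1 => /=; first lia.
by rewrite /candidate /= odd_double uphalf_double mulN1r.
Qed.
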